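(* Let $Y\subseteq\mathbb R^n$ be a nonempty bounded open convex set, and let $\psi:\mathbb R^n\to\mathbb R\cup\{+\infty\}$ be a proper lower semicontinuous convex function with $Y=\operatorname{int}(\operatorname{dom}(\psi))$. For $z\in\mathbb R^n$, define the solution map $$\bar w_\psi(z)\in\arg\min_{w\in\mathbb R^n}\{\langle z,w\rangle+\psi(w)\}.$$ Assume the following properties of $\bar w_\psi$: (i) for all $z\in\mathbb R^n$, $\bar w_\psi(z)$ is uniquely defined, i.e., the minimization problem $\min_{w\in\mathbb R^n}\{\langle z,w\rangle+\psi(w)\}$ always has a unique minimizer; (ii) the map $\bar w_\psi:\mathbb R^n\to Y$ is bijective and $L$-Lipschitz continuous for some $L>0$; (iii) the map $\bar w_\psi$ is differentiable everywhere. Then $\psi$ is $\mu$-strongly convex with $\mu=1/L$, $\psi$ is essentially smooth, and $\psi^*$ is twice differentiable on $\mathbb R^n$.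
   Context: $\operatorname{dom}(\psi)=\{w:\psi(w)<+\infty\}$, and $\psi^*(u)=\sup_{w}\{\langle u,w\rangle-\psi(w)\}$ is the convex conjugate. Lipschitz continuity and strong convexity are with respect to the Euclidean norm. Here $\psi$ with $Y=\operatorname{int}(\operatorname{dom}(\psi))$ is called essentially smooth if $\psi$ is differentiable on $Y$ and $\lim_{i\to\infty}|\nabla\psi(y^i)|=+\infty$ for every sequence $\{y^i\}_{i=1}^\infty\subseteq Y$ converging to a boundary point of $Y$. *)

(* Defs.v *)
From mathcomp Require Export all_boot all_order all_algebra.
From mathcomp Require Export all_classical all_reals all_analysis.
Export Order.TTheory GRing.Theory Num.Theory.
Export numFieldNormedType.Exports.

Set Implicit Arguments.
Unset Strict Implicit.
Unset Printing Implicit Defensive.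

Local Open Scope classical_set_scope.
Local Open Scope ring_scope.

(* R^n is ['rV[R]_n].  The library norm [`| x |] on it is the sup norm: it
   induces the usual topology, bounded sets and differentiability, but metric
   constants must be taken with respect to [enorm]. *)
Definition dotp (R : realType) (n : nat) (u v : 'rV[R]_n) : R :=
  \sum_(i < n) u 0 i * v 0 i.

Definition enorm (R : realType) (n : nat) (u : 'rV[R]_n) : R :=
  Num.sqrt (dotp u u).

Definition elipschitz (R : realType) (m n : nat) (L : R)
    (f : 'rV[R]_m -> 'rV[R]_n) : Prop :=
  forall x y, enorm (f x - f y) <= L * enorm (x - y).

Definition boundary (T : topologicalType) (A : set T) : set T :=
  closure A `\` interior A.

Section extended_real_valued_functions.
Variables (R : realType) (n : nat).
Implicit Types (psi : 'rV[R]_n -> \bar R) (f : 'rV[R]_n -> R).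

Definition edom psi : set 'rV[R]_n := [set w | (psi w < +oo)%E].

Definition eproper psi : Prop :=
  (forall w, (-oo < psi w)%E) /\ exists w, (psi w < +oo)%E.

Definition econvex psi : Prop :=
  forall (x y : 'rV[R]_n) (t : R), 0 < t < 1 ->
    (psi (t *: x + (1 - t) *: y)%R <= t%:E * psi x + (1 - t)%R%:E * psi y)%E.

Definition strongly_convex (mu : R) psi : Prop :=
  forall (x y : 'rV[R]_n) (t : R), 0 < t < 1 ->
    (psi (t *: x + (1 - t) *: y)%R <=
     t%:E * psi x + (1 - t)%R%:E * psi y
     - (mu / 2 * t * (1 - t) * enorm (x - y) ^+ 2)%R%:E)%E.

Definition conjugate psi : 'rV[R]_n -> \bar R :=
  fun u => ereal_sup [set ((dotp u w)%:E - psi w)%E | w in [set: 'rV[R]_n]].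

Definition argmin_tilt psi (z : 'rV[R]_n) : set 'rV[R]_n :=
  [set w | forall v, ((dotp z w)%:E + psi w <= (dotp z v)%:E + psi v)%E].

Definition grad f (x : 'rV[R]_n) : 'rV[R]_n :=
  \row_(i < n) 'D_(delta_mx 0 i) f x.

(* [fine] sends infinite values to 0, hence the finiteness requirement. *)
Definition ediff psi (x : 'rV[R]_n) : Prop :=
  (\forall y \near x, psi y \is a fin_num) /\ differentiable (fine \o psi) x.

Definition egrad psi : 'rV[R]_n -> 'rV[R]_n := grad (fine \o psi).

(* The second derivative is the differential of the gradient map; in particular
   psi must be finite near x. *)
Definition ediff2 psi (x : 'rV[R]_n) : Prop :=
  (\forall y \near x, ediff psi y) /\ differentiable (egrad psi) x.

Definition essentially_smooth psi : Prop :=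
  let Y := interior (edom psi) in
  (forall y, Y y -> ediff psi y) /\
  forall (u : nat -> 'rV[R]_n) (y : 'rV[R]_n),
    (forall i, Y (u i)) -> boundary Y y -> u i @[i --> \oo] --> y ->
    enorm (egrad psi (u i)) @[i --> \oo] --> +oo.

End extended_real_valued_functions.

(* Main.v *)
From HB Require Import structures.
Require Import Defs.
From mathcomp Require Import ring lra.

(* Put W u = wbar (- u).  The optimality of W u says that u is a subgradient of
   psi at W u and that psi^* u = <u, W u> - psi (W u), so W u is a subgradient
   of psi^* at u; as W is continuous, it is the gradient of psi^*, which is
   therefore twice differentiable.  The L-Lipschitz gradient gives a quadratic
   upper bound on psi^*, which dualizes to a quadratic lower bound on psi at
   every point of Y, that is, to strong convexity on Y; lower semicontinuity
   carries it to the boundary along segments towards a point of Y.  Finally,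
   U = W^-1 sends w in Y to a subgradient of psi at w.  It is continuous because
   it is locally bounded and W maps compact sets to compact sets, so it is the
   gradient of psi.  It blows up at the boundary because the image under W of a
   closed ball is a compact subset of Y. *)

Set Implicit Arguments.
Unset Strict Implicit.
Unset Printing Implicit Defensive.

Local Open Scope classical_set_scope.
Local Open Scope ring_scope.

(** * Inner product, Euclidean norm and sup norm *)

Lemma dotp_is_linear (R : realType) (n : nat) (p : 'rV[R]_n) :
  linear (dotp p : 'rV[R]_n -> R).
Proof.
move=> a u v; rewrite /dotp /= /GRing.scale /= mulr_sumr -big_split /=.
by apply: eq_bigr => i _; rewrite !mxE; ring.
Qed.

HB.instance Definition _ (R : realType) (n : nat) (p : 'rV[R]_n) :=
  GRing.isLinear.Build R 'rV[R]_n R *%R (dotp p) (@dotp_is_linear R n p).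

Lemma dotpC (R : realType) (n : nat) (u v : 'rV[R]_n) : dotp u v = dotp v u.
Proof. by apply: eq_bigr => i _; rewrite mulrC. Qed.

Lemma dotpDr (R : realType) (n : nat) (p u v : 'rV[R]_n) :
  dotp p (u + v) = dotp p u + dotp p v.
Proof. exact: linearD. Qed.

Lemma dotpNr (R : realType) (n : nat) (p u : 'rV[R]_n) :
  dotp p (- u) = - dotp p u.
Proof. exact: linearN. Qed.

Lemma dotpZr (R : realType) (n : nat) (a : R) (p u : 'rV[R]_n) :
  dotp p (a *: u) = a * dotp p u.
Proof. exact: linearZ. Qed.

Lemma dotpDl (R : realType) (n : nat) (p u v : 'rV[R]_n) :
  dotp (u + v) p = dotp u p + dotp v p.
Proof. by rewrite dotpC dotpDr !(dotpC p). Qed.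

Lemma dotpNl (R : realType) (n : nat) (p u : 'rV[R]_n) :
  dotp (- u) p = - dotp u p.
Proof. by rewrite dotpC dotpNr (dotpC p). Qed.

Lemma dotpZl (R : realType) (n : nat) (a : R) (p u : 'rV[R]_n) :
  dotp (a *: u) p = a * dotp u p.
Proof. by rewrite dotpC dotpZr (dotpC p). Qed.

Definition dotpE := (dotpDl, dotpDr, dotpNl, dotpNr, dotpZl, dotpZr).

Lemma dotp_delta (R : realType) (n : nat) (p : 'rV[R]_n) (i : 'I_n) :
  dotp p (delta_mx 0 i) = p 0 i.
Proof.
rewrite /dotp (bigD1 i) //= mxE !eqxx mulr1 big1 ?addr0 // => j ji.
by rewrite mxE (negPf ji) andbF mulr0.
Qed.

Lemma dotpvv_ge0 (R : realType) (n : nat) (u : 'rV[R]_n) : 0 <= dotp u u.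
Proof. by apply: sumr_ge0 => i _; rewrite -expr2 sqr_ge0. Qed.

Lemma enorm_sqr (R : realType) (n : nat) (u : 'rV[R]_n) :
  enorm u ^+ 2 = dotp u u.
Proof. by rewrite sqr_sqrtr // dotpvv_ge0. Qed.

Lemma rV_coord_le_norm (R : realType) (n : nat) (u : 'rV[R]_n) (i : 'I_n) :
  `|u 0 i| <= `|u|.
Proof.
rewrite [leRHS]/Num.Def.normr/= mx_normrE.
exact: (le_bigmax _ (fun ij : 'I_1 * 'I_n => `|u ij.1 ij.2|) (0, i)).
Qed.

Lemma rV_norm_le (R : realType) (n : nat) (u : 'rV[R]_n) (M : R) :
  0 <= M -> (forall i, `|u 0 i| <= M) -> `|u| <= M.
Proof.
move=> M0 uM; rewrite [leLHS]/Num.Def.normr/= mx_normrE.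
by apply/bigmax_leP; split => // -[i j] _; rewrite ord1.
Qed.

Lemma norm_le_enorm (R : realType) (n : nat) (u : 'rV[R]_n) : `|u| <= enorm u.
Proof.
apply: rV_norm_le => [|i]; first exact: sqrtr_ge0.
rewrite -sqrtr_sqr ler_wsqrtr // /dotp (bigD1 i) //= -expr2 lerDl.
by apply: sumr_ge0 => j _; rewrite -expr2 sqr_ge0.
Qed.

(** A crude Cauchy-Schwarz bound for the sup norm. The factor [n] is harmless in continuity and
    boundedness arguments; sharp constants go through [dotp_le_lipschitz]. *)
Lemma normr_dotp_le (R : realType) (n : nat) (u v : 'rV[R]_n) :
  `|dotp u v| <= n%:R * `|u| * `|v|.
Proof.
apply: (le_trans (ler_norm_sum _ _ _)).
apply: (@le_trans _ _ (\sum_(i < n) `|u| * `|v|)).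
  by apply: ler_sum => i _; rewrite normrM ler_pM // rV_coord_le_norm.
by rewrite sumr_const card_ord -mulrA mulr_natl.
Qed.

Lemma dotp_continuous (R : realType) (n : nat) (p : 'rV[R]_n) :
  continuous (dotp p : 'rV[R]_n -> R).
Proof.
apply/bounded_linear_continuous/linear_boundedP.
exists (n%:R * `|p|); split; first exact: num_real.
move=> r /ltW pr v; apply: le_trans (normr_dotp_le p v) _.
exact: ler_wpM2r.
Qed.

(** Expand 0 <= |L u - v|^2, bound |v|^2 by L^2 |u|^2 and divide by 2L. *)
Lemma dotp_le_lipschitz (R : realType) (n : nat) (L : R) (u v : 'rV[R]_n) :
  0 < L -> enorm v <= L * enorm u -> dotp u v <= L * dotp u u.
Proof.
move=> L0 vu; have := dotpvv_ge0 (L *: u - v).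
have : dotp v v <= L ^+ 2 * dotp u u.
  rewrite -!enorm_sqr -exprMn ler_sqr // nnegrE ?mulr_ge0 ?sqrtr_ge0 //.
  exact: ltW.
rewrite !dotpE (dotpC v u) => h1 h2.
rewrite -(ler_pM2l L0); lra.
Qed.

(** * Gradients from subgradients, and the descent lemma *)

(** The two inequalities squeeze f(x + h) - f(x) - <G x, h> between 0 and <G(x + h) - G x, h>, which
    is o(h) by continuity of [G] at [x]. *)
Lemma subgradient_grad (R : realType) (n : nat) (f : 'rV[R]_n -> R)
    (G : 'rV[R]_n -> 'rV[R]_n) (x : 'rV[R]_n) :
  {for x, continuous G} ->
  (\forall y \near x, f x + dotp (G x) (y - x) <= f y
                   /\ f y + dotp (G y) (x - y) <= f x) ->
  differentiable f x /\ grad f x = G x.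
Proof.
move=> Gx fx.
have exp e : 0 < e -> \forall h \near (0 : 'rV[R]_n),
    `|f (h + x) - (f x + dotp (G x) h)| <= e * `|h|.
  move=> e0.
  (* The divisor absorbs the factor [n] of [normr_dotp_le]; the 1 covers [n = 0]. *)
  have e0' : 0 < e / (n%:R + 1) by rewrite divr_gt0 // ltr_wpDl.
  have /nbhs0P near0 : \forall y \near x, `|G x - G y| <= e / (n%:R + 1) /\
      (f x + dotp (G x) (y - x) <= f y /\ f y + dotp (G y) (x - y) <= f x).
    near=> y; split; last by near: y.
    by near: y; move/cvgr_dist_le: Gx; exact.
  near=> h; rewrite (addrC h).
  have [Gh [h1 h2]] : `|G x - G (x + h)| <= e / (n%:R + 1) /\
      (f x + dotp (G x) (x + h - x) <= f (x + h) /\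
       f (x + h) + dotp (G (x + h)) (x - (x + h)) <= f x) by near: h.
  move: h1 h2.
  rewrite addrAC subrr add0r opprD addrA subrr add0r dotpNr => h1 h2.
  rewrite ger0_norm; last lra.
  have : dotp (G (x + h) - G x) h <= n%:R * `|G x - G (x + h)| * `|h|.
    by rewrite distrC; apply: le_trans (ler_norm _) (normr_dotp_le _ _).
  have : n%:R * `|G x - G (x + h)| * `|h| <= e * `|h|.
    apply: ler_wpM2r => //; apply: (@le_trans _ _ (n%:R * (e / (n%:R + 1)))).
      by rewrite ler_wpM2l.
    rewrite mulrCA ler_piMr ?(ltW e0) // ler_pdivrMr ?ltr_wpDl // mul1r.
    by rewrite lerDl.
  rewrite !dotpE; lra.
have dfE : 'd f x = dotp (G x) :> (_ -> _).
  by apply: diff_unique; [exact: dotp_continuous|apply/eqaddoP].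
have df : differentiable f x.
  apply/diff_locallyP; rewrite dfE; split; first exact: dotp_continuous.
  exact/eqaddoP.
split => //; apply/rowP => i.
by rewrite mxE deriveE // dfE dotp_delta.
Unshelve. all: by end_near. Qed.

(** The descent lemma, from subgradient inequalities alone: nothing is integrated along the
    segment. *)
Lemma gradient_lipschitz_le (R : realType) (n : nat) (L : R)
    (g : 'rV[R]_n -> R) (W : 'rV[R]_n -> 'rV[R]_n) :
  0 < L -> elipschitz L W ->
  (forall u v, g u + dotp (W u) (v - u) <= g v) ->
  forall u v, g v <= g u + dotp (W u) (v - u) + L / 2 * dotp (v - u) (v - u).
Proof.
move=> L0 Wlip gW.
(* Splitting the segment at its midpoint replaces a valid constant C by
   C / 2 + L / 4, whose iterates from L converge to L / 2. *)
have step k u v : g v <= g u + dotp (W u) (v - u)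
    + (L / 2 + L / 2 * 2^-1 ^+ k) * dotp (v - u) (v - u).
  elim: k u v => [|k IH] u v.
    (* The constant L comes from the subgradient inequality at [v], after replacing [W v] by [W u]
       at a cost of L |v - u|^2. *)
    have := dotp_le_lipschitz L0 (Wlip v u); have := gW v u.
    rewrite -(opprB v u) expr0 !dotpE !(dotpC _ (W _)); lra.
  have [m um vm] : exists2 m, m - u = 2^-1 *: (v - u) & v - m = 2^-1 *: (v - u).
    exists (2^-1 *: (u + v)); apply/rowP => i; rewrite !mxE; lra.
  have := IH u m; have := IH m v; have := dotp_le_lipschitz L0 (Wlip m u).
  rewrite um vm exprS; move: (v - u) (W m) (W u) => d a b.
  rewrite !dotpE !(dotpC d); set q := dotp d d; set c := 2^-1 ^+ k.
  lra.
move=> u v; apply/ler_addgt0Pr => e e0.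
set q := dotp (v - u) (v - u).
have q0 : 0 <= q := dotpvv_ge0 _.
(* The added 1 allows division even when [q] vanishes. *)
have Cq : 0 < L / 2 * q + 1 by have := mulr_ge0 (ltW L0) q0; lra.
have [k ke] : exists k, 2^-1 ^+ k <= e / (L / 2 * q + 1).
  have : (2^-1 : R) ^+ k @[k --> \oo] --> 0.
    by apply: cvg_expr; rewrite ger0_norm //; lra.
  move/cvgr_le/(_ _ (divr_gt0 e0 Cq)) => [k _ hk].
  by exists k; exact: (hk k (leqnn k)).
have := step k u v; rewrite -/q.
move: ke; rewrite ler_pdivlMr // => ke.
have : 0 <= (2^-1 : R) ^+ k by rewrite exprn_ge0.
set c := _ ^+ k in ke *; lra.
Qed.

(** * Tilted minimizers, subgradients and the conjugate *)

Lemma argmin_fin_num (R : realType) (n : nat) (psi : 'rV[R]_n -> \bar R)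
    (z w : 'rV[R]_n) :
  eproper psi -> argmin_tilt psi z w -> psi w \is a fin_num.
Proof.
move=> [psiNy [w0 w0y]] /(_ w0) min_w.
rewrite fin_numE gt_eqF //=; apply/negP => /eqP pw.
move: min_w w0y (psiNy w0); rewrite pw addey //.
by case: (psi w0).
Qed.

Lemma argmin_subgradient (R : realType) (n : nat) (psi : 'rV[R]_n -> \bar R)
    (u w : 'rV[R]_n) :
  eproper psi -> argmin_tilt psi (- u) w ->
  forall x, ((fine (psi w) + dotp u (x - w))%:E <= psi x)%E.
Proof.
move=> pr min_w x; have /fineK pw := argmin_fin_num pr min_w.
have := min_w x; have := pr.1 x; rewrite -pw.
case: (psi x) => [r _| _ _|//]; last exact: leey.
rewrite -!EFinD !lee_fin !dotpE; lra.
Qed.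

Lemma conjugate_argmin (R : realType) (n : nat) (psi : 'rV[R]_n -> \bar R)
    (u w : 'rV[R]_n) :
  eproper psi -> argmin_tilt psi (- u) w ->
  conjugate psi u = (dotp u w - fine (psi w))%:E.
Proof.
move=> pr min_w; have /fineK pw := argmin_fin_num pr min_w.
apply/eqP; rewrite eq_le; apply/andP; split.
  apply: ge_ereal_sup => _ [x _ <-].
  have := argmin_subgradient pr min_w x; have := pr.1 x.
  case: (psi x) => [r _| _ _|//]; last exact: leNye.
  rewrite -EFinB !lee_fin !dotpE; lra.
by apply: ereal_sup_ubound; exists w => //; rewrite -pw.
Qed.

Lemma argmin_strong_subgradient (R : realType) (n : nat)
    (psi : 'rV[R]_n -> \bar R) (W : 'rV[R]_n -> 'rV[R]_n) (L : R) :
  eproper psi -> (forall u, argmin_tilt psi (- u) (W u)) ->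
  0 < L -> elipschitz L W ->
  forall u x, ((fine (psi (W u)) + dotp u (x - W u)
    + (1 / L) / 2 * dotp (x - W u) (x - W u))%:E <= psi x)%E.
Proof.
move=> pr min_W L0 Wlip u x.
pose g v := dotp v (W v) - fine (psi (W v)).
have gW v v' : g v + dotp (W v) (v' - v) <= g v'.
  have := argmin_subgradient pr (min_W v') (W v).
  rewrite -(fineK (argmin_fin_num pr (min_W v))) lee_fin.
  rewrite /g !dotpE !(dotpC (W v)); lra.
(* Here [g] is the conjugate. Fenchel's inequality psi x >= <v, x> - g v and the descent lemma for g
   v give a lower bound concave in [v]; this [v] maximizes it, with quadratic gain |d|^2 / (2L). *)
pose d := x - W u; pose v := u + L^-1 *: d.
have xE : x = d + W u by rewrite subrK.
have vu : v - u = L^-1 *: d by rewrite addrAC subrr add0r.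
have := gradient_lipschitz_le L0 Wlip gW u v; rewrite vu.
have := argmin_subgradient pr (min_W v) x; have := pr.1 x.
case: (psi x) => [r _| _ _ _|//]; last by rewrite leey.
rewrite !lee_fin /g -/d {1}xE; move: (W v) (fine (psi (W v))) => b c.
clear vu; rewrite /v; clear v; clearbody d.
rewrite !dotpE !(dotpC d) => h1.
rewrite (_ : L / 2 * _ = 1 / L / 2 * dotp d d); first lra.
by field; rewrite gt_eqF.
Qed.

(** * Strong convexity up to the boundary of the domain *)

(** A point z near the combination m is the same combination of [x] and y + (z - m) / s, and the
    latter is close to [y], hence in the domain. *)
Lemma convex_combination_interior (R : realType) (n : nat)
    (psi : 'rV[R]_n -> \bar R) (x y : 'rV[R]_n) (s : R) :
  econvex psi -> (psi x < +oo)%E -> interior (edom psi) y -> 0 < s < 1 ->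
  interior (edom psi) (s *: y + (1 - s) *: x).
Proof.
move=> cvx px py /[dup] s01 /andP[s0 s1]; set m : 'rV[R]_n := _ + _.
have cvgm : (fun z : 'rV[R]_n => y + s^-1 *: (z - m)) @ m -->
    y + s^-1 *: (m - m).
  apply: (@cvgD _ _ _ (nbhs m)); first exact: cvg_cst.
  by apply: cvgZ; [exact: cvg_cst|apply: cvgB]; [exact: cvg_id|exact: cvg_cst].
rewrite subrr scaler0 addr0 in cvgm.
apply: (@filterS _ (nbhs m) _ _ _ _ (cvgm _ py)) => z /= dz.
have -> : z = s *: (y + s^-1 *: (z - m)) + (1 - s) *: x.
  rewrite scalerDr scalerA divff ?gt_eqF // scale1r addrAC -/m.
  by rewrite addrC subrK.
apply: le_lt_trans (cvx _ _ _ s01) _.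
by apply: lte_add_pinfty; apply: lte_mul_pinfty;
   rewrite ?lee_fin ?subr_ge0 // ltW.
Qed.

Lemma strongly_convex_subgradient (R : realType) (n : nat)
    (psi : 'rV[R]_n -> \bar R) (mu : R) :
  (forall w, (-oo < psi w)%E) -> econvex psi -> lower_semicontinuous psi ->
  interior (edom psi) !=set0 ->
  (forall w, interior (edom psi) w -> exists p, forall x,
     ((fine (psi w) + dotp p (x - w)
       + mu / 2 * dotp (x - w) (x - w))%:E <= psi x)%E) ->
  0 <= mu -> strongly_convex mu psi.
Proof.
move=> psiNy cvx lsc [w0 w0Y] subg mu0 x y t /[dup] t01 /andP[t0 t1].
have fin_int w : interior (edom psi) w -> psi w = (fine (psi w))%:E.
  by move=> /interior_subset wy; rewrite fineK // fin_numE gt_eqF //= lt_eqF.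
(* Average the subgradient inequalities at the combination with weights t and 1 - t: the linear
   terms cancel, and t (1 - t)^2 + (1 - t) t^2 = t (1 - t). Only the combination has to be
   interior. *)
have inner a b (ra rb : R) : psi a = ra%:E -> psi b = rb%:E ->
    interior (edom psi) (t *: a + (1 - t) *: b) ->
    fine (psi (t *: a + (1 - t) *: b)) <=
    t * ra + (1 - t) * rb - mu / 2 * t * (1 - t) * dotp (a - b) (a - b).
  move=> pa pb /subg[p sub].
  have := sub a; have := sub b; rewrite pa pb !lee_fin.
  set m := t *: a + _.
  have -> : a - m = (1 - t) *: (a - b).
    by apply/rowP => i; rewrite !mxE; ring.
  have -> : b - m = (- t) *: (a - b).
    by apply/rowP => i; rewrite !mxE; ring.
  rewrite !(dotpZl, dotpZr); set q := dotp _ _; set l := dotp _ _ => hb ha.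
  have := ler_wpM2l (ltW t0) ha.
  have t1' : 0 <= 1 - t by rewrite subr_ge0 ltW.
  have := ler_wpM2l t1' hb.
  lra.
have := psiNy y; have := psiNy x.
case px : (psi x) => [rx| |//] _; last first.
  by move=> py; rewrite gt0_muley ?lte_fin // addye ?leey //;
     case: (psi y) py => //= *; rewrite ?ltNye // gt0_muley ?lte_fin ?subr_gt0.
case py : (psi y) => [ry| |//] _; last first.
  by rewrite gt0_muley ?lte_fin ?subr_gt0 // addey ?leey.
rewrite enorm_sqr.
set m := t *: x + _; set q := dotp _ _.
have q0 : 0 <= q := dotpvv_ge0 _.
rewrite -!EFinM -!EFinD.
have my : (psi m < +oo)%E.
  by apply: le_lt_trans (cvx _ _ _ t01) _; rewrite px py -!EFinM -EFinD ltry.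
have pm : psi m = (fine (psi m))%:E.
  by rewrite fineK // fin_numE gt_eqF //= lt_eqF.
rewrite pm lee_fin leNgt; apply/negP => Bm.
set B := (X in X < _) in Bm.
(* If the bound [B] failed at [m], lower semicontinuity would keep [psi] above this intermediate
   level near [m]. *)
pose a := (B + fine (psi m)) / 2.
have [V Vm Va] : exists2 V, nbhs m V & forall z, V z -> (a%:E < psi z)%E.
  by apply: lsc; rewrite pm lte_fin /a; lra.
pose r0 := fine (psi w0).
(* Moving [x], [y] and [m] towards [w0] by a fraction s turns the bound into B + s K minus a
   nonnegative multiple of s^2. For small s this is below [a], although the moved [m] is interior
   and [inner] applies there. *)
pose K := r0 - (t * rx + (1 - t) * ry) + mu * t * (1 - t) * q.
have cvgm : s *: w0 + (1 - s) *: m @[s --> (0 : R)^'+] -->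
    (0 : R) *: w0 + (1 - 0) *: m.
  have id0 : s @[s --> (0 : R)^'+] --> (0 : R).
    exact: cvg_at_right_filter cvg_id.
  apply: cvgD; apply: cvgZ; [exact: id0|exact: cvg_cst| |exact: cvg_cst].
  by apply: cvgB; [exact: cvg_cst|exact: id0].
rewrite scale0r add0r subr0 scale1r in cvgm.
near (0 : R)^'+ => s.
have s0 : 0 < s by [].
have s1 : s < 1 by near: s; apply: nbhs_right_lt.
have sK : s * (`|K| + 1) < a - B.
  have K1 : 0 < `|K| + 1 by rewrite ltr_wpDl.
  rewrite -ltr_pdivlMr //; near: s; apply: nbhs_right_lt.
  by rewrite divr_gt0 // /a; lra.
have s01 : 0 < s < 1 by rewrite s0.
have sm : (a%:E < psi (s *: w0 + (1 - s) *: m)%R)%E.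
  by near: s; apply: (@cvgm [set z | (a%:E < psi z)%E]);
     exact: filterS Va Vm.
have dm := convex_combination_interior cvx my w0Y s01.
have seg z (rz : R) : psi z = rz%:E ->
    exists2 rs : R, psi (s *: w0 + (1 - s) *: z) = rs%:E
                  & rs <= s * r0 + (1 - s) * rz.
  move=> pz; have := cvx w0 z s s01; rewrite pz (fin_int _ w0Y) -!EFinM -EFinD.
  have := psiNy (s *: w0 + (1 - s) *: z).
  by case: (psi _) => [rs _|//|//]; rewrite lee_fin; exists rs.
have [rxs pxs rxsle] := seg _ _ px.
have [rys pys rysle] := seg _ _ py.
have mE : s *: w0 + (1 - s) *: m =
    t *: (s *: w0 + (1 - s) *: x) + (1 - t) *: (s *: w0 + (1 - s) *: y).
  by apply/rowP => i; rewrite !mxE; ring.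
move: sm; rewrite (fin_int _ dm) lte_fin.
move: dm; rewrite mE => /(inner _ _ _ _ pxs pys).
have -> : s *: w0 + (1 - s) *: x - (s *: w0 + (1 - s) *: y) =
    (1 - s) *: (x - y).
  by apply/rowP => i; rewrite !mxE; ring.
rewrite dotpZl dotpZr -/q => h1 h2.
have t1' : 0 <= 1 - t by rewrite subr_ge0 ltW.
have hx := ler_wpM2l (ltW t0) rxsle.
have hy := ler_wpM2l t1' rysle.
have sK' : s * K <= s * (`|K| + 1).
  by rewrite ler_pM2l // (le_trans (ler_norm _)) // lerDl.
have Q0 : 0 <= mu / 2 * t * (1 - t) * q * s ^+ 2.
  by rewrite !mulr_ge0 // ?sqr_ge0 ?(ltW t0) // invr_ge0.
suff : fine (psi m) < fine (psi m) by rewrite ltxx.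
move: hx hy sK' sK h1 h2 Q0; rewrite /K /a /B /r0; lra.
Unshelve. all: by end_near. Qed.

(** * The right inverse of [W]: continuity and blow-up *)

Lemma norm_ball_compact (R : realType) (n : nat) (M : R) :
  compact [set p : 'rV[R]_n | `|p| <= M].
Proof.
apply: bounded_closed_compact.
  exists M; split; first exact: num_real.
  by move=> r Mr p /= /le_trans; apply; exact: ltW.
apply: (@preimage_closed _ _ (@Num.norm R 'rV[R]_n) [set r | r <= M]).
  by move=> p _; exact: norm_continuous.
exact: closed_le.
Qed.

(** Remove from the ball of radius [M] an open neighbourhood of [U w]. The image of the rest under
    [W] is compact, and misses [w] by injectivity, so [U y] stays in that neighbourhood for [y] near
    [w]. *)
Lemma right_inverse_continuous (R : realType) (n : nat)
    (W U : 'rV[R]_n -> 'rV[R]_n) (w : 'rV[R]_n) (M : R) :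
  continuous W -> injective W -> (\forall y \near w, W (U y) = y) ->
  (\forall y \near w, `|U y| <= M) -> {for w, continuous U}.
Proof.
move=> Wc Winj WU UM A /= UA.
have [B AB [oB BUw]] : exists2 B, B `<=` A & open B /\ B (U w).
  by move: UA; rewrite nbhsE => -[B [oB Bw] BA]; exists B.
pose K := [set p : 'rV[R]_n | `|p| <= M] `&` ~` B.
have cWK : closed (W @` K).
  apply: compact_closed; first exact: norm_hausdorff.
  apply: continuous_compact; first exact: continuous_subspaceT.
  apply: compact_closedI; first exact: norm_ball_compact.
  exact: open_closedC.
have WKw : nbhs w (~` (W @` K)).
  apply: open_nbhs_nbhs; split; first exact: closed_openC.
  move=> [p [_ nBp]]; rewrite -{1}(nbhs_singleton WU) => /Winj pU.
  by apply: nBp; rewrite pU.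
suff : \forall y \near w, A (U y) by [].
near=> y; apply: AB; apply: contrapT => nB.
have : (~` (W @` K)) y by near: y.
apply; exists (U y); last by near: y.
by split => //=; near: y.
Unshelve. all: by end_near. Qed.

(** Testing the subgradient at [y] against the points w + d e_i and w - d e_i bounds each coordinate
    of [U y], up to an error due to y <> w. *)
Lemma subgradient_locally_bounded (R : realType) (n : nat)
    (f : 'rV[R]_n -> R) (U : 'rV[R]_n -> 'rV[R]_n) (Y : set 'rV[R]_n)
    (w : 'rV[R]_n) (C : R) :
  nbhs w Y -> (forall y, Y y -> C <= f y) ->
  (forall x y, Y x -> Y y -> f y + dotp (U y) (x - y) <= f x) ->
  exists M, \forall y \near w, `|U y| <= M.
Proof.
move=> /[dup] Yw /nbhs_normP[r /= r0 rY] Cf subg.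
pose d := r / 2.
have d0 : 0 < d by rewrite divr_gt0.
have inY (a : R) i : `|a| = 1 -> Y (w + (a * d) *: delta_mx 0 i).
  move=> a1; apply: rY => /=.
  rewrite opprD addrA subrr sub0r normrN normrZ normrM a1 mul1r.
  rewrite ger0_norm ?(ltW d0) //.
  apply: (@le_lt_trans _ _ d); last by rewrite /d; lra.
  rewrite ler_piMr ?(ltW d0) //; apply: rV_norm_le => // j.
  by rewrite mxE; case: eqP => // _; case: eqP => // _;
     rewrite ?normr1 ?normr0.
pose S := \sum_(i < n) (`|f (w + (1 * d) *: delta_mx 0 i)| +
                        `|f (w + (- 1 * d) *: delta_mx 0 i)|) + `|C|.
have fS (a : R) i : a = 1 \/ a = - 1 ->
    f (w + (a * d) *: delta_mx 0 i) - C <= S.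
  move=> a1; apply: lerD; last by rewrite -normrN ler_norm.
  rewrite (bigD1 i) //= -[leLHS]addr0; apply: lerD.
    by case: a1 => ->; [rewrite -[leLHS]addr0|rewrite -[leLHS]add0r];
       apply: lerD => //; exact: ler_norm.
  by apply: sumr_ge0 => j _; rewrite addr_ge0.
exists (2 * S / d); near=> y.
have Yy : Y y by near: y.
(* So close to [w], the error <U y, w - y> is at most half of d |U y| and is absorbed on the left,
   whence the bound 2 S / d. *)
have wy : n%:R * `|w - y| <= d / 2.
  apply: (@le_trans _ _ (n%:R * (d / 2 / (n%:R + 1)))).
    apply: ler_wpM2l => //; near: y; apply: cvgr_dist_le; first exact: cvg_id.
    by rewrite !divr_gt0 // ltr_wpDl.
  rewrite mulrCA ler_piMr //; first by rewrite divr_ge0 // ltW.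
  rewrite ler_pdivrMr ?ltr_wpDl //.
  by rewrite mul1r lerDl.
have S0 : 0 <= S by rewrite addr_ge0 // sumr_ge0 // => i _; rewrite addr_ge0.
have Udot : `|dotp (U y) (w - y)| <= d / 2 * `|U y|.
  apply: le_trans (normr_dotp_le _ _) _.
  by rewrite mulrAC; apply: ler_wpM2r.
suff : `|U y| <= (S + d / 2 * `|U y|) / d.
  rewrite !ler_pdivlMr //; lra.
apply: rV_norm_le => [|i].
  by rewrite divr_ge0 ?(ltW d0) // addr_ge0 // mulr_ge0 // divr_ge0 // ltW.
have key (a : R) : a = 1 \/ a = - 1 -> d * (a * U y 0 i) <= S + d / 2 * `|U y|.
  move=> a1; have Ya := inY a i.
  have /Ya{}Ya : `|a| = 1 by case: a1 => ->; rewrite ?normrN normr1.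
  have := subg _ _ Ya Yy; have := fS _ i a1; have := Cf _ Yy.
  have : - dotp (U y) (w - y) <= d / 2 * `|U y|.
    by apply: le_trans Udot; rewrite -normrN ler_norm.
  rewrite !dotpE dotp_delta; lra.
rewrite ler_pdivlMr // mulrC.
have := key 1 (or_introl erefl); have := key (- 1) (or_intror erefl).
by case: (ler0P (U y 0 i)) => _; rewrite ?mulN1r ?mul1r.
Unshelve. all: by end_near. Qed.

(** Wherever |U| stays below A, the sequence lies in the image under [W] of a closed sup-norm ball,
    a closed subset of [Y] that misses the limit [y]. *)
Lemma right_inverse_blowup (R : realType) (n : nat)
    (W U : 'rV[R]_n -> 'rV[R]_n) (Y : set 'rV[R]_n)
    (u : nat -> 'rV[R]_n) (y : 'rV[R]_n) :
  continuous W -> (forall p, Y (W p)) -> (forall w, Y w -> W (U w) = w) ->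
  (forall i, Y (u i)) -> ~ Y y -> u i @[i --> \oo] --> y ->
  enorm (U (u i)) @[i --> \oo] --> +oo.
Proof.
move=> Wc YW WU Yu nYy uy; apply/cvgryPge => A.
pose K := W @` [set p : 'rV[R]_n | `|p| <= A].
have cK : closed K.
  apply: compact_closed; first exact: norm_hausdorff.
  apply: continuous_compact; last exact: norm_ball_compact.
  exact: continuous_subspaceT.
have Ky : nbhs y (~` K).
  apply: open_nbhs_nbhs; split; first exact: closed_openC.
  by move=> [p _ py]; apply: nYy; rewrite -py.
have := uy _ Ky; apply: (@filterS _ \oo) => i /= nK.
rewrite leNgt; apply/negP => UA; apply: nK; exists (U (u i)); last exact: WU.
exact: le_trans (norm_le_enorm _) (ltW UA).
Qed.

(** * Assembling the three conclusions *)

Theorem proposition1 (R : realType) (n : nat)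
  (Y : set 'rV[R]_n) (psi : 'rV[R]_n -> \bar R)
  (wbar : 'rV[R]_n -> 'rV[R]_n) (L : R)
  (Y_neq0 : Y !=set0) (Y_bounded : bounded_set Y)
  (Y_open : open Y) (Y_convex : convex_set Y)
  (psi_proper : eproper psi) (psi_lsc : lower_semicontinuous psi)
  (psi_convex : econvex psi) (psi_dom : Y = interior (edom psi))
  (wbar_argmin : forall z, argmin_tilt psi z (wbar z))
  (wbar_unique : forall z, exists! w, argmin_tilt psi z w)
  (wbar_bij : set_bij [set: 'rV[R]_n] Y wbar)
  (L_gt0 : 0 < L) (wbar_lipschitz : elipschitz L wbar)
  (wbar_diff : forall z, differentiable wbar z) :
  [/\ strongly_convex (1 / L) psi,
      essentially_smooth psi
    & forall u, ediff2 (conjugate psi) u].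
Proof.
pose W u := wbar (- u).
have min_W u : argmin_tilt psi (- u) (W u) by exact: wbar_argmin.
have W_lipschitz : elipschitz L W.
  move=> x y; apply: le_trans (wbar_lipschitz _ _) _.
  by rewrite -opprD /enorm dotpNl dotpNr opprK.
have W_diff u : differentiable W u.
  exact: (@differentiable_comp _ _ _ _ -%R wbar).
have Wc : continuous W by move=> u; exact: differentiable_continuous.
have YW u : Y (W u) by case: wbar_bij => + _ _; apply.
have Winj : injective W.
  move=> u v uv; case: wbar_bij => _ inj _; apply: oppr_inj.
  by apply: inj uv; rewrite inE.
have [U WU] : exists U, forall w, Y w -> W (U w) = w.
  (* Putting [Y w] inside the existential makes [U] total; its values off [Y] are arbitrary. *)
  have surj w : exists p, Y w -> W p = w.
    have [Yw|nYw] := pselect (Y w); last by exists 0.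
    case: wbar_bij => _ _ /(_ w Yw)[p _ pw].
    by exists (- p); rewrite /W opprK.
  by exists (fun w => projT1 (cid (surj w))) => w; exact: projT2 (cid (surj w)).
have fin_Y w : Y w -> psi w = (fine (psi w))%:E.
  by move=> /WU <-; rewrite (fineK (argmin_fin_num psi_proper (min_W _))).
have subg x y : Y x -> Y y ->
    fine (psi y) + dotp (U y) (x - y) <= fine (psi x).
  move=> Yx Yy; have := argmin_subgradient psi_proper (min_W (U y)) x.
  by rewrite WU // (fin_Y x Yx) lee_fin.
have psi_grad w : Y w ->
    differentiable (fine \o psi) w /\ egrad psi w = U w.
  move=> Yw; have nYw : nbhs w Y by exact: open_nbhs_nbhs.
  apply: subgradient_grad.
    have [M UM] : exists M, \forall y \near w, `|U y| <= M.
      (* The lower bound is the global minimum of [psi], attained at [W 0] since 0 is a subgradient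
         there. *)
      apply: (@subgradient_locally_bounded _ _ (fine \o psi) U Y w
                (fine (psi (W 0)))) => // y Yy.
      have := argmin_subgradient psi_proper (min_W 0) y.
      by rewrite (fin_Y y Yy) lee_fin dotpC linear0 addr0.
    by apply: (right_inverse_continuous Wc Winj _ UM); apply: filterS nYw.
  by apply: filterS nYw => y Yy; split; exact: subg.
split.
- apply: strongly_convex_subgradient => //.
  + exact: psi_proper.1.
  + by rewrite -psi_dom.
  + rewrite -psi_dom => w Yw; exists (U w) => x.
    have := argmin_strong_subgradient psi_proper min_W L_gt0 W_lipschitz
              (U w) x.
    by rewrite WU.
  + by rewrite divr_ge0 // ltW.
- rewrite /essentially_smooth -psi_dom; split=> [y Yy|u y Yu [_ nYy] uy].
    split; last exact: (psi_grad y Yy).1.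
    have := open_nbhs_nbhs (conj Y_open Yy); apply: filterS => x Yx.
    by rewrite (fin_Y x Yx).
  have -> : (fun i => enorm (egrad psi (u i))) = (fun i => enorm (U (u i))).
    by apply/funext => i; rewrite (psi_grad _ (Yu i)).2.
  apply: (@right_inverse_blowup _ _ W U Y _ _ _ _ _ _ _ uy) => //.
  by move=> Yy; apply: nYy; exact: (open_nbhs_nbhs (conj Y_open Yy)).
- pose g u := dotp u (W u) - fine (psi (W u)).
  have conjE : conjugate psi = EFin \o g.
    by apply/funext => u; exact: conjugate_argmin.
  (* This is the subgradient inequality of [psi] at [W v], tested at [W u] and rearranged. *)
  have gW u v : g u + dotp (W u) (v - u) <= g v.
    have := argmin_subgradient psi_proper (min_W v) (W u).
    rewrite (fin_Y _ (YW u)) lee_fin /g !dotpE !(dotpC (W u)); lra.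
  have g_grad u : differentiable g u /\ grad g u = W u.
    by apply: subgradient_grad; [exact: Wc|near=> y].
  have gradE : egrad (conjugate psi) = W.
    by apply/funext => u; rewrite /egrad conjE (g_grad u).2.
  move=> u; rewrite /ediff2 gradE; split; last exact: W_diff.
  near=> v; rewrite /ediff conjE; split; last exact: (g_grad v).1.
  by near=> x.
Unshelve. all: by end_near. Qed.
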